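(* Let $\mathcal{G}$ be a sparsity pattern on $n$ $\alpha$-nodes and $m$ $\beta$-nodes. If $\mathcal{G}$ is structurally controllable, then $\mathcal{G}$ is structurally averaged controllable. Likewise, if $\mathcal{G}$ is structurally ensemble controllable, then $\mathcal{G}$ is structurally averaged controllable.
   Context: Let $n,m$ be positive integers and $\Sigma=[0,1]$. Sparsity patterns. A sparsity pattern is a directed graph $\mathcal{G}=(V,\mathcal{E})$ (self-loops allowed) with node set $V=\{\alpha_1,\ldots,\alpha_n,\beta_1,\ldots,\beta_m\}$ such that no $\beta$-node has an incoming edge. Compliant pairs. A pair $(A,B)$, with $A$ of size $n\times n$ and $B$ of size $n\times m$, is compliant with $\mathcal{G}$ if: the $(j,i)$ entry of $A$ is zero (identically zero, if $A$ is a function) whenever $(\alpha_i,\alpha_j)\notin\mathcal{E}$, and the $(j,i)$ entry of $B$ is (identically) zero whenever $(\beta_i,\alpha_j)\notin\mathcal{E}$. In the ensemble setting, $\mathbb{V}(\mathcal{G})$ denotes the vector space of all pairs $(A,B)\in \mathrm{C}^0(\Sigma,\mathbb{R}^{n\times n}\times\mathbb{R}^{n\times m})$ compliant with $\mathcal{G}$. Ensemble system. Given continuous $A:\Sigma\to\mathbb{R}^{n\times n}$ and $B:\Sigma\to\mathbb{R}^{n\times m}$, the associated linear ensemble system is $$\frac{\partial}{\partial t}x(t,\sigma)=A(\sigma)x(t,\sigma)+B(\sigma)u(t),\qquad \sigma\in\Sigma,\ t\ge 0, \tag{E}$$ with $x(t,\sigma)\in\mathbb{R}^n$ and a control input $u(t)\in\mathbb{R}^m$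 that does not depend on $\sigma$. Averaged controllability. System (E) is averaged controllable if for any $x_0\in\mathbb{R}^n$ and any initial profile $x(0,\cdot)\in \mathrm{C}^0(\Sigma,\mathbb{R}^n)$ with $\int_0^1 x(0,\sigma)\,\mathrm{d}\sigma=x_0$, any target $x^*\in\mathbb{R}^n$, and any time $T>0$, there is $u\in \mathrm{L}^1([0,T];\mathbb{R}^m)$ such that $\int_0^1 x(T,\sigma)\,\mathrm{d}\sigma=x^*$. $\mathrm{L}^p$-controllability ($1\le p\le\infty$). System (E) is $\mathrm{L}^p$-controllable if for any initial profile $x(0,\cdot)\in\mathrm{C}^0(\Sigma,\mathbb{R}^n)$, any target profile $x^*\in \mathrm{C}^0(\Sigma,\mathbb{R}^n)$, any $\epsilon>0$ and any $T>0$, there is $u\in \mathrm{L}^1([0,T];\mathbb{R}^m)$ such that $\|x(T,\cdot)-x^*\|_{\mathrm{L}^p}<\epsilon$. Structural notions. - $\mathcal{G}$ is structurally controllable if there is a pair of constant matrices $(A,B)\in\mathbb{R}^{n\times n}\times\mathbb{R}^{n\times m}$ compliant with $\mathcal{G}$ such that the linear time-invariant system $\dot x(t)=Ax(t)+Bu(t)$ is controllable. - $\mathcal{G}$ is structurally ensemble controllable if there is a pair $(A,B)\in\mathbb{V}(\mathcal{G})$ (continuous functions on $\Sigma$) such that (E) is $\mathrm{L}^p$-controllable for some $p\in[1,\infty]$ (this notion is known not to depend on $p$). - $\mathcal{G}$ is structurally averaged controllable if there is a pair $(A,B)\in\mathbb{V}(\mathcal{G})$ (continuous functions on $\Sigma$)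 such that (E) is averaged controllable. *)

(* Defs.v *)
From HB Require Import structures.
From mathcomp Require Import all_boot all_order all_algebra.
From mathcomp Require Import all_classical all_reals all_analysis.
Set Implicit Arguments.
Unset Strict Implicit.
Unset Printing Implicit Defensive.
Import Order.TTheory GRing.Theory Num.Theory.
Import numFieldNormedType.Exports.
Local Open Scope classical_set_scope.
Local Open Scope ring_scope.

(* The node alpha_i is [inl i] and the node beta_j is [inr j]. *)
Record sparsity_pattern (n m : nat) := SparsityPattern {
  edge : rel ('I_n + 'I_m);
  edge_beta : forall (v : 'I_n + 'I_m) (j : 'I_m), ~~ edge v (inr j)
}.

Section Definitions.
Variables (R : realType) (n m : nat).
Implicit Type G : sparsity_pattern n m.

Local Notation mu := (@lebesgue_measure R).

Definition Sigma : set R := `[0, 1].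

Definition compliant G (A : 'M[R]_n) (B : 'M[R]_(n, m)) : Prop :=
  (forall i j : 'I_n, ~~ edge G (inl i) (inl j) -> A j i = 0) /\
  (forall (i : 'I_m) (j : 'I_n), ~~ edge G (inr i) (inl j) -> B j i = 0).

(* The space V(G) of continuous compliant pairs. Functions on Sigma are
   represented by total functions on R, whose values outside Sigma are
   irrelevant. *)
Definition ensemble_space G (A : R -> 'M[R]_n) (B : R -> 'M[R]_(n, m)) : Prop :=
  [/\ {within Sigma, continuous A}, {within Sigma, continuous B} &
      forall s, Sigma s -> compliant G (A s) (B s)].

Definition L1_control (T : R) (u : R -> 'cV[R]_m) : Prop :=
  forall i : 'I_m, mu.-integrable `[0, T] (fun t => (u t i 0)%:E).

(* Integral of a vector-valued function, coordinate by coordinate. *)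
Definition vintegral (k : nat) (D : set R) (f : R -> 'cV[R]_k) : 'cV[R]_k :=
  \col_i Rintegral mu D (fun t => f t i 0).

(* x' = A x + B u on [0, T]. As u is only integrable, solutions are meant in the
   sense of Caratheodory: x is continuous and satisfies the integrated equation
   (equivalently, x is absolutely continuous and satisfies the differential
   equation almost everywhere). *)
Definition trajectory (A : 'M[R]_n) (B : 'M[R]_(n, m)) (T : R)
    (u : R -> 'cV[R]_m) (x : R -> 'cV[R]_n) : Prop :=
  {within `[0, T], continuous x} /\
  forall t, 0 <= t <= T ->
    x t = x 0 + vintegral `[0, t] (fun s => A *m x s + B *m u s).

(* The first argument of x is the time, the second one the parameter. *)
Definition ensemble_trajectory (A : R -> 'M[R]_n) (B : R -> 'M[R]_(n, m))
    (T : R) (u : R -> 'cV[R]_m) (x : R -> R -> 'cV[R]_n) : Prop :=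
  forall s, Sigma s -> trajectory (A s) (B s) T u (fun t => x t s).

Definition lti_controllable (A : 'M[R]_n) (B : 'M[R]_(n, m)) : Prop :=
  forall (x0 xstar : 'cV[R]_n) (T : R), 0 < T ->
  exists (u : R -> 'cV[R]_m) (x : R -> 'cV[R]_n),
    [/\ L1_control T u, trajectory A B T u x, x 0 = x0 & x T = xstar].

(* Trajectories with a given initial profile are unique on [0, T] x Sigma, so
   the existential quantifier on x only names the solution driven by u. *)
Definition averaged_controllable (A : R -> 'M[R]_n) (B : R -> 'M[R]_(n, m)) :
    Prop :=
  forall (x0 : 'cV[R]_n) (xinit : R -> 'cV[R]_n),
    {within Sigma, continuous xinit} -> vintegral Sigma xinit = x0 ->
  forall (xstar : 'cV[R]_n) (T : R), 0 < T ->
  exists (u : R -> 'cV[R]_m) (x : R -> R -> 'cV[R]_n),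
    [/\ L1_control T u, ensemble_trajectory A B T u x,
        (forall s, Sigma s -> x 0 s = xinit s) &
        vintegral Sigma (x T) = xstar].

Definition enorm (k : nat) (v : 'cV[R]_k) : R :=
  Num.sqrt (\sum_(i < k) v i 0 ^+ 2).

(* The L^p norm on Sigma, obtained by extending |f| by 0 outside Sigma. *)
Definition Lp_norm (p : \bar R) (k : nat) (f : R -> 'cV[R]_k) : \bar R :=
  Lnorm mu p ((fun s => (enorm (f s))%:E) \_ Sigma).

Definition Lp_controllable (p : \bar R) (A : R -> 'M[R]_n)
    (B : R -> 'M[R]_(n, m)) : Prop :=
  forall xinit xstar : R -> 'cV[R]_n,
    {within Sigma, continuous xinit} -> {within Sigma, continuous xstar} ->
  forall eps T : R, 0 < eps -> 0 < T ->
  exists (u : R -> 'cV[R]_m) (x : R -> R -> 'cV[R]_n),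
    [/\ L1_control T u, ensemble_trajectory A B T u x,
        (forall s, Sigma s -> x 0 s = xinit s) &
        (Lp_norm p (fun s => x T s - xstar s)%R < eps%:E)%E].

Definition structurally_controllable G : Prop :=
  exists (A : 'M[R]_n) (B : 'M[R]_(n, m)),
    compliant G A B /\ lti_controllable A B.

Definition structurally_ensemble_controllable G : Prop :=
  exists (A : R -> 'M[R]_n) (B : R -> 'M[R]_(n, m)),
    ensemble_space G A B /\
    exists p : \bar R, (1 <= p)%E /\ Lp_controllable p A B.

Definition structurally_averaged_controllable G : Prop :=
  exists (A : R -> 'M[R]_n) (B : R -> 'M[R]_(n, m)),
    ensemble_space G A B /\ averaged_controllable A B.

End Definitions.

Arguments Sigma : clear implicits.
Arguments structurally_controllable R {n m} G.
Arguments structurally_ensemble_controllable R {n m} G.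
Arguments structurally_averaged_controllable R {n m} G.

(* Main.v *)
Require Import Defs.
From mathcomp Require Import all_boot all_order all_algebra.
From mathcomp Require Import all_classical all_reals all_analysis.
From mathcomp Require Import measurable_realfun ess_sup_inf.
From mathcomp Require Import ring lra.
Set Implicit Arguments.
Unset Strict Implicit.
Unset Printing Implicit Defensive.
Import Order.TTheory GRing.Theory Num.Theory.
Import numFieldNormedType.Exports.
Local Open Scope classical_set_scope.
Local Open Scope ring_scope.

(** Averages of trajectories depend affinely on the control, and live in the
    finite-dimensional space [R^n]; both implications exploit this.

    If [G] is structurally controllable, take a controllable compliant pair
    [(A, B)] and regard it as constant in the parameter. A control that steers
    the mean [x0] of the initial profile [xinit] to [xstar] along a trajectory
    [x] drives the whole ensemble along
    [y t s = exp(tA) (xinit s - x0) + x t]. The deviations [xinit s - x0] have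
    mean zero, so the mean of [y T] is [x T = xstar]
    ([averaged_controllable_cst]). The matrix exponential [expmx] is built
    entry by entry as a power series, and [trajectory_expmx] shows that it
    solves the homogeneous equation.

    If [G] is structurally ensemble controllable, the same pair [(A, B)] is
    averaged controllable ([averaged_controllable_of_Lp]). The averages at time
    [T] of the trajectories that start from the zero profile form a linear
    subspace [W] of [R^n]. Steering the zero profile close to a constant profile
    [y] in [L^p] brings the average close to [y], since on a space of measure
    one the [L^1] norm is at most the [L^p] norm ([Lnorm1_restrict_le]). So [W]
    is dense, hence equal to [R^n] ([dense_subspace_full]), and adding suitable
    elements of [W] corrects the average reached by any one trajectory that
    starts from the given profile.

    The integral over the parameter is linear only on integrable profiles, while
    a family of trajectories is a priori just one solution for each value of the
    parameter. Its regularity comes from [trajectory_continuous_parameter]: by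
    the integral inequality [gronwall], the state at time [T] depends
    continuously on the coefficients and the initial value. *)

(** * Vector-valued integrals *)

Section Vectors.
Variable R : realType.
Local Notation mu := (@lebesgue_measure R).

Lemma le_mx_entry m n (M : 'M[R]_(m, n)) i j : `|M i j| <= `|M|.
Proof.
by rewrite [leRHS]/Num.norm /= mx_normrE; apply: (le_bigmax _ _ (i, j)).
Qed.

Lemma mx_norm_le m n (M : 'M[R]_(m, n)) c :
  0 <= c -> (forall i j, `|M i j| <= c) -> `|M| <= c.
Proof.
move=> c0 Mc; rewrite [leLHS]/Num.norm /= mx_normrE.
by apply: bigmax_le => // -[i j] _; exact: Mc.
Qed.

Lemma norm_mulmx_le m n p (M : 'M[R]_(m, n)) (N : 'M[R]_(n, p)) :
  `|M *m N| <= n%:R * `|M| * `|N|.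
Proof.
apply: mx_norm_le => [|i j]; first by rewrite !mulr_ge0.
rewrite mxE (le_trans (ler_norm_sum _ _ _))//.
rewrite -mulrA mulr_natl -[X in _ *+ X]card_ord -sumr_const.
by apply: ler_sum => l _; rewrite normrM ler_pM// le_mx_entry.
Qed.

Definition vintegrable k (D : set (measurableTypeR R)) (f : R -> 'cV[R]_k) :=
  forall i, mu.-integrable D (fun t => (f t i 0)%:E).

Lemma eq_vintegral k (D : set (measurableTypeR R)) (f g : R -> 'cV[R]_k) :
  {in D, f =1 g} -> vintegral D f = vintegral D g.
Proof.
move=> fg; apply/matrixP => i j; rewrite !mxE.
by apply: eq_Rintegral => t tD; rewrite fg.
Qed.

Lemma vintegrable_lin k (D : set (measurableTypeR R)) (a : R)
    (f g : R -> 'cV[R]_k) :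
  measurable D -> vintegrable D f -> vintegrable D g ->
  vintegrable D (fun t => a *: f t + g t).
Proof.
move=> mD vf vg i.
under eq_fun do rewrite !mxE EFinD EFinM.
by apply: integrableD => //; exact: integrableZl.
Qed.

Lemma vintegral_lin k (D : set (measurableTypeR R)) (a : R)
    (f g : R -> 'cV[R]_k) :
  measurable D -> vintegrable D f -> vintegrable D g ->
  vintegral D (fun t => a *: f t + g t) = a *: vintegral D f + vintegral D g.
Proof.
move=> mD vf vg; apply/colP => i; rewrite !mxE.
rewrite -RintegralZl//; last exact: vf.
rewrite -RintegralD//; last exact: vg.
  by apply: eq_Rintegral => t _; rewrite !mxE.
have := integrableZl mD a (vf i).
by under eq_fun do rewrite -EFinM.
Qed.

Lemma vintegrable_mulmx k l (D : set (measurableTypeR R)) (M : 'M[R]_(l, k))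
    (f : R -> 'cV[R]_k) :
  measurable D -> vintegrable D f -> vintegrable D (fun t => M *m f t).
Proof.
move=> mD vf i; under eq_fun do rewrite mxE -sumEFin.
apply: integrable_sum => // j _.
under eq_fun do rewrite EFinM.
exact: integrableZl.
Qed.

Lemma Rintegral_sum (I : finType) (D : set (measurableTypeR R)) (f : I -> R -> R) :
  measurable D -> (forall i, mu.-integrable D (EFin \o f i)) ->
  \int[mu]_(t in D) (\sum_i f i t) = \sum_i \int[mu]_(t in D) f i t.
Proof.
move=> mD If.
suff H (s : seq I) : mu.-integrable D (EFin \o (fun t => \sum_(i <- s) f i t)) /\
    \int[mu]_(t in D) (\sum_(i <- s) f i t) =
      \sum_(i <- s) \int[mu]_(t in D) f i t by exact: (H _).2.
elim: s => [|i s [IH1 IH2]].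
  have -> : (fun t => \sum_(i <- [::]) f i t) = cst 0.
    by apply/funext => t; rewrite big_nil.
  by split; [exact: integrable0|rewrite big_nil /Rintegral integral0].
have -> : (fun t => \sum_(j <- i :: s) f j t) =
          (fun t => f i t + \sum_(j <- s) f j t).
  by apply/funext => t; rewrite big_cons.
split; last by rewrite big_cons -IH2 -RintegralD.
exact: (integrableD mD (If i) IH1).
Qed.

Lemma vintegral_mulmx k l (D : set (measurableTypeR R)) (M : 'M[R]_(l, k))
    (f : R -> 'cV[R]_k) :
  measurable D -> vintegrable D f ->
  vintegral D (fun t => M *m f t) = M *m vintegral D f.
Proof.
move=> mD vf; apply/colP => i; rewrite !mxE.
under eq_Rintegral do rewrite mxE.
rewrite Rintegral_sum//.
  by apply: eq_bigr => j _; rewrite mxE RintegralZl//; exact: vf.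
move=> j; have := integrableZl mD (M i j) (vf j).
by under eq_fun do rewrite -EFinM.
Qed.

Lemma cvg_mx_entry m n (T : Type) (F : set_system T) {FF : Filter F}
    (f : T -> 'M[R]_(m, n)) (M : 'M[R]_(m, n)) i j :
  f x @[x --> F] --> M -> f x i j @[x --> F] --> M i j.
Proof.
move=> fM; apply: (@cvg_comp _ _ _ f (fun N : 'M[R]_(m, n) => N i j) _ _ _ fM).
exact: coord_continuous.
Qed.

Lemma within_continuous_entry m n (D : set R) (f : R -> 'M[R]_(m, n)) i j :
  {within D, continuous f} -> {within D, continuous (fun t => f t i j)}.
Proof. by move=> cf x; apply: cvg_mx_entry; exact: cf. Qed.

Lemma vintegrable_continuous k (a b : R) (f : R -> 'cV[R]_k) :
  {within `[a, b], continuous f} -> vintegrable `[a, b] f.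
Proof.
move=> cf i; apply: (@continuous_compact_integrable R (fun t => f t i 0)).
  exact: segment_compact.
exact: within_continuous_entry.
Qed.

Lemma normr_vintegral_le k (D : set (measurableTypeR R)) (f : R -> 'cV[R]_k)
    (g : R -> R) :
  measurable D -> vintegrable D f -> mu.-integrable D (EFin \o g) ->
  (forall t, D t -> `|f t| <= g t) -> `|vintegral D f| <= \int[mu]_(t in D) g t.
Proof.
move=> mD vf ig fg; apply: mx_norm_le.
  by apply: Rintegral_ge0 => t Dt; exact: le_trans (fg _ Dt).
move=> i j; rewrite mxE (le_trans (le_normr_Rintegral mD (vf i)))//.
apply: le_Rintegral => //; first exact: integrable_norm (vf i).
by move=> t Dt; exact: le_trans (le_mx_entry _ _ _) (fg _ Dt).
Qed.

End Vectors.

(** * Trajectories *)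

Section Trajectories.
Variables (R : realType) (n m : nat).
Local Notation mu := (@lebesgue_measure R).
Implicit Types (A : 'M[R]_n) (B : 'M[R]_(n, m)) (T : R).

Lemma trajectory_vintegrable A B T u x t :
  L1_control T u -> {within `[0, T], continuous x} -> t <= T ->
  vintegrable `[0, t] (fun s => A *m x s + B *m u s).
Proof.
move=> uT cx tT.
have sub : `[0, t] `<=` `[0, T] by apply: subset_itvl; rewrite bnd_simp.
have vx : vintegrable `[0, t] x.
  by apply: vintegrable_continuous; exact: continuous_subspaceW cx.
have vu : vintegrable `[0, t] u.
  by move=> i; apply: integrableS (uT i).
have -> : (fun s => A *m x s + B *m u s) = (fun s => 1 *: (A *m x s) + B *m u s).
  by apply/funext => s; rewrite scale1r.
by apply: vintegrable_lin => //; exact: vintegrable_mulmx.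
Qed.

(** The equation is linear in the state and the control jointly. This makes the
    averages reachable from the zero profile a linear subspace, and allows a
    homogeneous solution to be added to a controlled one. *)
Lemma trajectory_lin A B T (a : R) u v x y :
  L1_control T u -> L1_control T v ->
  trajectory A B T u x -> trajectory A B T v y ->
  trajectory A B T (fun t => a *: u t + v t) (fun t => a *: x t + y t).
Proof.
move=> uT vT [cx ex] [cy ey]; split.
  apply: (@within_continuousD _ _ _ _ (fun t => a *: x t)) => // t.
  exact: (cvgZl_tmp (k := a) (cx t)).
move=> t /andP[t0 tT].
rewrite ex ?t0// ey ?t0// scalerDr addrACA; congr (_ + _).
rewrite -vintegral_lin//; try exact: trajectory_vintegrable.
apply: eq_vintegral => s _.
by rewrite !mulmxDr -!scalemxAr scalerDr addrACA.
Qed.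

Lemma L1_control_lin T (a : R) (u v : R -> 'cV[R]_m) :
  L1_control T u -> L1_control T v -> L1_control T (fun t => a *: u t + v t).
Proof. by move=> uT vT; apply: vintegrable_lin. Qed.

Lemma L1_control0 T : L1_control T (fun=> 0 : 'cV[R]_m).
Proof.
by move=> i; rewrite mxE; exact: integrable0.
Qed.

End Trajectories.

Section FTC.
Variable R : realType.
Local Notation mu := (@lebesgue_measure R).

Lemma Rintegral_derive (f F : R -> R) (t : R) : 0 <= t ->
  (forall x : R, is_derive x (1 : R) F (f x)) -> continuous f ->
  \int[mu]_(x in `[0, t]) f x = F t - F 0.
Proof.
rewrite le_eqVlt => /predU1P[<- _ _|t0 dF cf].
  by rewrite set_itv1 Rintegral_set1 subrr.
have cF : continuous F.
  by move=> x; apply/differentiable_continuous/derivable1_diffP/ex_derive.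
rewrite /Rintegral (@continuous_FTC2 _ f F)//.
- exact: continuous_subspaceT.
- split; first by move=> x _; exact: ex_derive.
  + by apply: cvg_at_right_filter; exact: cF.
  + by apply: cvg_at_left_filter; exact: cF.
- by move=> x _; rewrite derive1E; exact: derive_val.
Qed.
End FTC.

(** * The homogeneous flow *)

Lemma cvg_mx (R : realType) m n (T : Type) (F : set_system T) {FF : Filter F}
    (f : T -> 'M[R]_(m, n)) (M : 'M[R]_(m, n)) :
  (forall i j, f x i j @[x --> F] --> M i j) -> f x @[x --> F] --> M.
Proof.
move=> fM; apply/cvgrPdist_le => e e0.
suff : \forall x \near F, forall ij : 'I_m * 'I_n,
    `|M ij.1 ij.2 - f x ij.1 ij.2| <= e.
  apply: filterS => x Mf; apply: mx_norm_le => [|i j]; first exact: ltW.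
  by rewrite !mxE; exact: (Mf (i, j)).
apply: filter_forall => -[i j].
by have /cvgrPdist_le := fM i j; exact.
Qed.

Lemma cvg_mulmx (R : realType) m n p (M : 'M[R]_(m, n)) (T : Type)
    (F : set_system T) {FF : Filter F} (f : T -> 'M[R]_(n, p)) (N : 'M[R]_(n, p)) :
  f x @[x --> F] --> N -> M *m f x @[x --> F] --> M *m N.
Proof.
move=> fN; apply: cvg_mx => i j; rewrite mxE; under eq_fun do rewrite mxE.
apply: cvg_big => [|l _]; first exact: add_continuous.
apply: cvgMl_tmp.
exact: cvg_mx_entry.
Qed.

Section Flow.
Variables (R : realType) (n : nat) (A : 'M[R]_n).
Local Notation mu := (@lebesgue_measure R).

(** The coefficients of the [(i, j)] entry of [M exp(tA)] as a power series in
    [t]. The left factor [M] makes the family stable under formal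
    differentiation, which turns [M] into [M A]. *)
Definition expmx_coeff (M : 'M[R]_n) (i j : 'I_n) (k : nat) : R :=
  (M *m A ^+ k) i j / k`!%:R.

Lemma pseries_diffs_expmx M i j :
  pseries_diffs (expmx_coeff M i j) = expmx_coeff (M *m A) i j.
Proof.
apply/funext => k; rewrite /pseries_diffs /expmx_coeff.
rewrite exprS mulmxA factS natrM invfM.
by rewrite mulrCA mulrA -mulrA mulVKf ?pnatr_eq0// mulrC.
Qed.

Lemma norm_expmx_le k : `|A ^+ k| <= (n%:R * `|A|) ^+ k.
Proof.
elim: k => [|k IH].
  rewrite !expr0; apply: mx_norm_le => // i j.
  by rewrite mxE; case: eqP; rewrite ?normr1 ?normr0.
rewrite !exprS (le_trans (norm_mulmx_le _ _))//.
by rewrite ler_wpM2l// mulr_ge0.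
Qed.

Lemma cvg_expmx M i j z : cvgn (pseries (expmx_coeff M i j) z).
Proof.
apply: normed_cvg.
apply: (@series_le_cvg _ _
  (fun k => n%:R * `|M| * exp_coeff (n%:R * `|A| * `|z|) k)) => [k|k|k|].
- exact: normr_ge0.
- by rewrite mulr_ge0 ?mulr_ge0// exp_coeff_ge0// !mulr_ge0.
- rewrite /expmx_coeff /exp_coeff /= !normrM normrX normfV normr_nat.
  rewrite -mulrA (mulrC _^-1) exprMn !mulrA ler_wpM2r ?invr_ge0//.
  rewrite ler_wpM2r ?exprn_ge0// (le_trans (le_mx_entry _ _ _))//.
  rewrite (le_trans (norm_mulmx_le _ _))// ler_wpM2l ?mulr_ge0//.
  exact: norm_expmx_le.
- apply: is_cvg_seriesZ.
  exact: is_cvg_series_exp_coeff.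
Qed.

Definition expmx_series (M : 'M[R]_n) (t : R) : 'M[R]_n :=
  \matrix_(i, j) limn (pseries (expmx_coeff M i j) t).

Definition expmx (t : R) : 'M[R]_n := expmx_series 1%:M t.

(** The factor [M] comes out of the series; with [pseries_diffs_expmx] this
    turns termwise differentiation into the equation [E' = A E]. *)
Lemma expmx_seriesE M t : expmx_series M t = M *m expmx t.
Proof.
apply/matrixP => i j; rewrite !mxE.
under eq_bigr do rewrite mxE.
apply: cvg_lim => //.
have -> : pseries (expmx_coeff M i j) t =
    (fun N => \sum_l M i l * pseries (expmx_coeff 1%:M l j) t N).
  apply/funext => N; rewrite /pseries /series /=.
  under [RHS]eq_bigr do rewrite mulr_sumr.
  rewrite exchange_big /=; apply: eq_bigr => k _.
  rewrite /expmx_coeff mxE !mulr_suml; apply: eq_bigr => l _.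
  by rewrite mul1mx !mulrA.
apply: cvg_big => [|l _]; first exact: add_continuous.
by apply: cvgMl_tmp; exact: cvg_expmx.
Qed.

(** Termwise differentiation of a power series requires convergence of its first
    two formal derivatives, which are again of the form [expmx_coeff]. *)
Lemma is_derive_expmx i j (t : R) :
  is_derive t (1 : R) (fun s => expmx s i j) ((A *m expmx t) i j).
Proof.
rewrite -expmx_seriesE mxE -[A]mul1mx -pseries_diffs_expmx.
have -> : (fun s => expmx s i j) =
    (fun s => limn (pseries (expmx_coeff 1%:M i j) s)).
  by apply/funext => s; rewrite mxE.
apply: (@pseries_snd_diffs _ _ (`|t| + 1)); rewrite ?pseries_diffs_expmx;
  try exact: cvg_expmx.
by rewrite [ltRHS]ger0_norm ?addr_ge0// ltrDl.
Qed.

Lemma expmx0 : expmx 0 = 1%:M.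
Proof.
apply/matrixP => i j; rewrite mxE.
apply: cvg_lim => //; apply: cvg_near_cst; near=> k.
have k0 : (0 < k)%N by near: k; exact: nbhs_infty_gt.
rewrite /pseries /series /= -(prednK k0) big_nat_recl// expr0.
rewrite big1 => [|l _]; last by rewrite expr0n mulr0.
by rewrite /expmx_coeff expr0 mulmx1 fact0 divr1 mulr1 addr0.
Unshelve. all: by end_near. Qed.

Lemma is_derive_expmx_mul (v : 'cV[R]_n) i (t : R) :
  is_derive t (1 : R) (fun s => (expmx s *m v) i 0) ((A *m (expmx t *m v)) i 0).
Proof.
rewrite mulmxA mxE.
have -> : (fun s => (expmx s *m v) i 0) =
    (\sum_j (fun s => expmx s i j * v j 0)).
  by apply/funext => s; rewrite mxE fct_sumE.
apply: is_derive_sum => j.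
have := is_deriveM (is_derive_expmx i j t) (is_derive_cst (v j 0) t (1:R)).
by rewrite scaler0 add0r [_ *: _]mulrC.
Qed.

Lemma continuous_expmx_mul (v : 'cV[R]_n) :
  continuous (fun t => expmx t *m v).
Proof.
move=> t; apply: cvg_mx => i j; rewrite ord1.
apply/differentiable_continuous/derivable1_diffP/ex_derive.
exact: is_derive_expmx_mul.
Qed.

Lemma trajectory_expmx m (B : 'M[R]_(n, m)) T v :
  trajectory A B T (fun=> 0) (fun t => expmx t *m v).
Proof.
split; first by apply: continuous_subspaceT; exact: continuous_expmx_mul.
move=> t /andP[t0 _]; rewrite expmx0 mul1mx; apply/colP => i; rewrite !mxE.
under eq_Rintegral do rewrite mulmx0 addr0.
rewrite (Rintegral_derive t0 (is_derive_expmx_mul v i)).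
  by rewrite expmx0 mul1mx mxE addrC subrK.
move=> s; apply: cvg_mx_entry; apply: cvg_mulmx.
exact: continuous_expmx_mul.
Qed.

End Flow.

(** * Averages over the parameter *)

Section Averages.
Variables (R : realType) (n m : nat).
Local Notation mu := (@lebesgue_measure R).

Lemma lebesgue_measure_Sigma : mu (Sigma R) = 1%E.
Proof.
by rewrite /Sigma lebesgue_measure_itv /= lte_fin ltr01 oppr0 adde0.
Qed.

Lemma vintegral_Sigma_cst k (v : 'cV[R]_k) : vintegral (Sigma R) (fun=> v) = v.
Proof.
apply/colP => i; rewrite mxE Rintegral_cst; last exact: measurable_itv.
by rewrite [X in fine X]lebesgue_measure_Sigma mulr1.
Qed.

Lemma vintegrable_Sigma k (f : R -> 'cV[R]_k) :
  {within Sigma R, continuous f} -> vintegrable (Sigma R) f.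
Proof. exact: vintegrable_continuous. Qed.

(** The control is chosen for the mean state alone: the deviations from the mean
    follow the homogeneous flow, and their average stays zero because the matrix
    of this flow does not depend on the parameter. *)
Lemma averaged_controllable_cst (A : 'M[R]_n) (B : 'M[R]_(n, m)) :
  lti_controllable A B -> averaged_controllable (fun=> A) (fun=> B).
Proof.
move=> ctrl x0 xinit cxinit xinit0 xstar T T0.
have [u [x [uT tx xx0 xTs]]] := ctrl x0 xstar T T0.
exists u, (fun t s => 1 *: (expmx A t *m (xinit s - x0)) + x t); split=> //.
- move=> s _.
  have := trajectory_lin 1 (L1_control0 T) uT
    (trajectory_expmx A B T (xinit s - x0)) tx.
  by under eq_fun do rewrite scaler0 add0r.
- by move=> s _; rewrite expmx0 mul1mx xx0 scale1r subrK.
- have mS : measurable (Sigma R : set (measurableTypeR R)) by exact: measurable_itv.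
  have cS (v : 'cV[R]_n) : vintegrable (Sigma R) (fun=> v).
    by apply: vintegrable_Sigma; apply: continuous_subspaceT => t; exact: cvg_cst.
  have iS := vintegrable_Sigma cxinit.
  have vS : vintegrable (Sigma R) (fun s => xinit s - x0).
    have := vintegrable_lin 1 mS iS (cS (- x0)).
    by under eq_fun do rewrite scale1r.
  rewrite vintegral_lin//; last exact: vintegrable_mulmx.
  rewrite scale1r vintegral_mulmx// vintegral_Sigma_cst xTs.
  suff -> : vintegral (Sigma R) (fun s => xinit s - x0) = 0.
    by rewrite mulmx0 add0r.
  under eq_fun do rewrite -[xinit _]scale1r.
  by rewrite vintegral_lin// vintegral_Sigma_cst xinit0 scale1r subrr.
Qed.

End Averages.

(** * Continuity of trajectories in the parameter *)

Section Gronwall.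
Variable R : realType.
Local Notation mu := (@lebesgue_measure R).

Lemma Rintegral_expR (a t : R) : a != 0 -> 0 <= t ->
  \int[mu]_(s in `[0, t]) expR (a * s) = a^-1 * (expR (a * t) - 1).
Proof.
move=> a0 t0.
have d (x : R) : is_derive x (1 : R) (fun s => a^-1 * expR (a * s)) (expR (a * x)).
  apply: is_derive_eq.
  by rewrite /GRing.scale /= mulr1 mulrCA mulVf ?mulr1.
rewrite (Rintegral_derive t0 d); last first.
  move=> x; apply: continuous_comp; last exact: continuous_expR.
  by apply: cvgMl_tmp; exact: cvg_id.
by rewrite mulr0 expR0 mulrBr.
Qed.

(** Let [M] be the maximum of the weighted function [phi t * exp(-2Kt)], reached
    at [tau]. Since [phi s <= M exp(2Ks)] and the integral of [K exp(2Ks)] over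
    [[0, tau]] is at most half of [exp(2K tau)], the hypothesis at [tau],
    multiplied by [exp(-2K tau)], gives [M <= c + M / 2]. The exponent [2K]
    instead of [K] and the factor 2 are the price for not iterating the
    inequality. *)
Lemma gronwall (T K c : R) (phi : R -> R) : 0 <= T -> 0 < K ->
  {within `[0, T], continuous phi} ->
  (forall t, 0 <= t <= T -> 0 <= phi t) ->
  (forall t, 0 <= t <= T -> phi t <= c + \int[mu]_(s in `[0, t]) (K * phi s)) ->
  phi T <= 2 * c * expR (2 * K * T).
Proof.
move=> T0 K0 cphi phi0 phile.
have K20 : 2 * K != 0 by rewrite mulf_neq0 ?gt_eqF.
have [tau tauT maxtau] : exists2 tau, tau \in `[0, T]%R &
    forall t, t \in `[0, T]%R ->
      phi t * expR (- (2 * K * t)) <= phi tau * expR (- (2 * K * tau)).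
  apply: EVT_max => // t; apply: cvgM; first exact: cphi.
  suff : continuous (fun t : R => expR (- (2 * K * t))).
    by move=> /(@continuous_subspaceT _ _ `[0, T]); exact.
  move=> {}t; apply: continuous_comp; last exact: continuous_expR.
  by apply: cvgN; apply: cvgMl_tmp; exact: cvg_id.
set M := phi tau * _ in maxtau.
have phiM t : 0 <= t <= T -> phi t <= M * expR (2 * K * t).
  by move=> tT; rewrite -ler_pdivrMr ?expR_gt0// -expRN; exact: maxtau.
move: tauT; rewrite in_itv /= => /andP[tau0 tauT].
have c0 : 0 <= c.
  have := phile 0; rewrite lexx T0 => /(_ isT).
  rewrite set_itv1 Rintegral_set1 addr0; apply: le_trans.
  by rewrite phi0// lexx T0.
have M0 : 0 <= M by rewrite mulr_ge0 ?expR_ge0// phi0// tau0.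
have phitau : phi tau <= c + M / 2 * (expR (2 * K * tau) - 1).
  apply: (le_trans (phile _ _)); first by rewrite tau0.
  rewrite lerD2l.
  have -> : M / 2 * (expR (2 * K * tau) - 1) =
      \int[mu]_(s in `[0, tau]) (K * M * expR (2 * K * s)).
    rewrite RintegralZl//.
      rewrite Rintegral_expR//; move: (expR _) => E. by field; rewrite gt_eqF.
    apply: continuous_compact_integrable; first exact: segment_compact.
    apply: continuous_subspaceT => t.
    apply: continuous_comp; last exact: continuous_expR.
    by apply: cvgMl_tmp; exact: cvg_id.
  apply: le_Rintegral => //.
  - apply: continuous_compact_integrable; first exact: segment_compact.
    move=> t; apply: cvgMl_tmp.
    have : {within `[0, tau], continuous phi}.
      by apply: continuous_subspaceW cphi; apply: subset_itvl; rewrite bnd_simp.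
    exact.
  - apply: continuous_compact_integrable; first exact: segment_compact.
    apply: continuous_subspaceT => t; apply: cvgMl_tmp.
    apply: continuous_comp; last exact: continuous_expR.
    by apply: cvgMl_tmp; exact: cvg_id.
  - move=> s; rewrite /= in_itv /= => /andP[s0 st].
    by rewrite -mulrA ler_wpM2l ?(ltW K0)// phiM// s0 (le_trans st).
have M2c : M <= 2 * c.
  have E1 : 1 <= expR (2 * K * tau) by rewrite -expR0 ler_expR !mulr_ge0// ltW.
  have ME : phi tau = M * expR (2 * K * tau).
    by rewrite /M -mulrA -expRD addNr expR0 mulr1.
  move: phitau; rewrite ME; move: (expR _) E1 => E E1 h.
  have h2 : M * E <= 2 * c by nra.
  by apply: le_trans h2; rewrite ler_peMr.
apply: (le_trans (phiM T _)); first by rewrite T0 lexx.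
by rewrite ler_wpM2r ?expR_ge0.
Qed.

End Gronwall.

Section ParameterDependence.
Variables (R : realType) (n m : nat).
Local Notation mu := (@lebesgue_measure R).

Lemma norm_cV_le_sum k (v : 'cV[R]_k) : `|v| <= \sum_i `|v i 0|.
Proof.
apply: mx_norm_le => [|i j]; first exact: sumr_ge0.
by rewrite ord1 (bigD1 i)//= lerDl sumr_ge0.
Qed.

(** Over a bounded time interval the trajectory is a locally Lipschitz function
    of the data: the difference [d] of two trajectories with the same control
    satisfies [d' = A d + (A - A') x' + (B - B') u], to which the integral
    inequality above applies. *)
Lemma trajectory_dist_le (A A' : 'M[R]_n) (B B' : 'M[R]_(n, m))
    (T : R) u x x' (K eta M : R) :
  0 <= T -> 0 < K -> 0 <= eta -> 0 <= M -> L1_control T u ->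
  trajectory A B T u x -> trajectory A' B' T u x' ->
  n%:R * `|A| <= K -> `|A - A'| <= eta -> `|B - B'| <= eta ->
  `|x 0 - x' 0| <= eta -> (forall t, 0 <= t <= T -> `|x' t| <= M) ->
  `|x T - x' T| <= 2 * (eta * (1 + \int[mu]_(t in `[0, T])
      (n%:R * M + m%:R * \sum_i `|u t i 0|))) * expR (2 * K * T).
Proof.
move=> T0 K0 eta0 M0 uT tx tx' AK dA dB d0 xM.
pose d t := -1 *: x' t + x t.
have dE t : x t - x' t = d t by rewrite /d scaleN1r addrC.
rewrite dE; pose g t := n%:R * M + m%:R * \sum_i `|u t i 0|.
have g0 t : 0 <= g t by rewrite addr_ge0 ?mulr_ge0// sumr_ge0.
have [cx ex] := tx; have [cx' ex'] := tx'.
have cd : {within `[0, T], continuous d}.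
  apply: (@within_continuousD _ _ _ _ (fun t => -1 *: x' t)) => // t.
  exact: (cvgZl_tmp (k := -1) (cx' t)).
have cnd : {within `[0, T], continuous (fun t => `|d t|)}.
  by move=> t; apply: cvg_norm; exact: cd.
have mT t : measurable (`[0, t] : set (measurableTypeR R)).
  exact: measurable_itv.
have ig : mu.-integrable `[0, T] (EFin \o g).
  have icst : mu.-integrable `[0, T] (EFin \o (fun=> n%:R * M)).
    apply: continuous_compact_integrable; first exact: segment_compact.
    by apply: continuous_subspaceT => t; exact: cvg_cst.
  have isum : mu.-integrable `[0, T] (fun t => \sum_i `|u t i 0|%:E)%E.
    by apply: integrable_sum => // i _; exact: integrable_norm (uT i).
  have := integrableD (mT T) icst (integrableZl (mT T) m%:R isum).
  apply: eq_integrable => // t _.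
  by rewrite /= sumEFin.
apply: (gronwall (phi := fun t => `|d t|)) => // t /andP[t0 tT].
have sub : `[0, t] `<=` `[0, T] by apply: subset_itvl; rewrite bnd_simp.
have igt : mu.-integrable `[0, t] (EFin \o g) by exact: integrableS ig.
have id : mu.-integrable `[0, t] (EFin \o (fun s => K * `|d s|)).
  apply: continuous_compact_integrable; first exact: segment_compact.
  move=> s; apply: cvgMl_tmp.
  have : {within `[0, t], continuous (fun t => `|d t|)}.
    exact: continuous_subspaceW cnd.
  exact.
have gle : \int[mu]_(s in `[0, t]) (eta * g s) <=
    eta * \int[mu]_(s in `[0, T]) g s.
  rewrite RintegralZl// ler_wpM2l// /Rintegral fine_le//.
  - exact: integrable_fin_num.
  - exact: integrable_fin_num.
  - apply: ge0_subset_integral => //.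
      by case/integrableP : ig.
    by move=> s _; rewrite lee_fin.
have -> : d t = d 0 + vintegral `[0, t] (fun s => -1 *: (A' *m x' s + B' *m u s)
                                               + (A *m x s + B *m u s)).
  rewrite vintegral_lin//; [|exact: trajectory_vintegrable..].
  rewrite /d ex ?t0// ex' ?t0// scalerDr addrACA.
  by rewrite addrACA.
rewrite (le_trans (ler_normD _ _))// mulrDr mulr1 -addrA lerD//.
  by rewrite -dE.
apply: le_trans (lerD gle (lexx _)).
have iegt := integrableZl (mT t) eta igt.
rewrite -RintegralD//; apply: normr_vintegral_le => //.
- by apply: vintegrable_lin => //; exact: trajectory_vintegrable.
- exact: (integrableD (mT t) iegt id).
move=> s; rewrite /= in_itv /= => /andP[s0 st].
have -> : -1 *: (A' *m x' s + B' *m u s) + (A *m x s + B *m u s) =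
    A *m d s + (A - A') *m x' s + (B - B') *m u s.
  rewrite /d mulmxDr -scalemxAr !mulmxBl !scaleN1r opprD.
  move: (A *m _) (A' *m _) (A *m _) (B *m _) (B' *m _) => a1 a2 a3 b1 b2.
  by apply/colP => i; rewrite !mxE; ring.
have -> : eta * g s + K * `|d s| =
    K * `|d s| + n%:R * eta * M + m%:R * eta * \sum_i `|u s i 0|.
  by rewrite /g; ring.
rewrite (le_trans (ler_normD _ _))// lerD//.
  rewrite (le_trans (ler_normD _ _))// lerD//.
    by rewrite (le_trans (norm_mulmx_le _ _))// ler_wpM2r.
  rewrite (le_trans (norm_mulmx_le _ _))// ler_pM ?mulr_ge0 ?ler_wpM2l//.
  by rewrite xM// s0 (le_trans st).
rewrite (le_trans (norm_mulmx_le _ _))// ler_pM ?mulr_ge0 ?ler_wpM2l//.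
exact: norm_cV_le_sum.
Qed.

(** This is what makes the final state of an ensemble integrable in the
    parameter. The constants [K], [M] and [C] are uniform near [s]: only the
    fixed trajectory at [s] has to be bounded, and [`|A s'| <= `|A s| + 1]. *)
Lemma trajectory_continuous_parameter (D : set R) (A : R -> 'M[R]_n)
    (B : R -> 'M[R]_(n, m)) T u (x : R -> R -> 'cV[R]_n) : 0 <= T ->
  {within D, continuous A} -> {within D, continuous B} -> L1_control T u ->
  (forall s, D s -> trajectory (A s) (B s) T u (fun t => x t s)) ->
  {within D, continuous (x 0)} -> {within D, continuous (x T)}.
Proof.
move=> T0 /subspace_continuousP cA /subspace_continuousP cB uT tx
  /subspace_continuousP cx; apply/subspace_continuousP => s Ds.
have [M [M0 xM]] : exists M, 0 <= M /\ forall t, 0 <= t <= T -> `|x t s| <= M.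
  have [cxs _] := tx s Ds.
  have [tau _ maxtau] : exists2 tau, tau \in `[0, T]%R &
      forall t, t \in `[0, T]%R -> `|x t s| <= `|x tau s|.
    by apply: EVT_max => // t; apply: cvg_norm; exact: cxs.
  by exists `|x tau s|; split.
(* The final [+ 1] in [K] and [C] only ensures positivity, for instance when
   [n = 0]; the cap [eta <= 1] below keeps [n |A s'|] under [K]. *)
pose K := n%:R * (`|A s| + 1) + 1.
have K0 : 0 < K by rewrite ltr_wpDl// mulr_ge0// addr_ge0.
pose C := 2 * (1 + \int[mu]_(t in `[0, T])
  (n%:R * M + m%:R * \sum_i `|u t i 0|)) * expR (2 * K * T) + 1.
have C0 : 0 < C.
  rewrite ltr_wpDl// mulr_ge0 ?expR_ge0// mulr_ge0// addr_ge0//.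
  by apply: Rintegral_ge0 => t _; rewrite addr_ge0 ?mulr_ge0// sumr_ge0.
apply/cvgrPdist_le => e e0.
pose eta := Num.min 1 (e / C).
have eta0 : 0 < eta by rewrite lt_min ltr01 divr_gt0.
have eta1 : eta <= 1 by rewrite ge_min lexx.
have etae : eta * C <= e by rewrite -ler_pdivlMr// ge_min lexx orbT.
have /cvgrPdist_le/(_ _ eta0) nA := cA s Ds.
have /cvgrPdist_le/(_ _ eta0) nB := cB s Ds.
have /cvgrPdist_le/(_ _ eta0) nx := cx s Ds.
near=> s'.
have Ds' : D s' by near: s'; exact: withinT.
have dA : `|A s' - A s| <= eta by rewrite distrC; near: s'.
have dB : `|B s' - B s| <= eta by rewrite distrC; near: s'.
have dx : `|x 0 s' - x 0 s| <= eta by rewrite distrC; near: s'.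
have AK : n%:R * `|A s'| <= K.
  rewrite (@le_trans _ _ (n%:R * (`|A s| + 1)))// ?lerDl// ler_wpM2l//.
  rewrite -[A s'](subrK (A s)) addrC (le_trans (ler_normD _ _))// lerD2l.
  exact: le_trans dA _.
rewrite distrC (le_trans (trajectory_dist_le T0 K0 (ltW eta0) M0 uT
  (tx _ Ds') (tx _ Ds) AK dA dB dx xM))// (le_trans _ etae)// /C.
set I := \int[mu]_(_ in _) _; set E := expR _.
have -> : 2 * (eta * (1 + I)) * E = eta * (2 * (1 + I) * E) by ring.
by rewrite ler_wpM2l ?(ltW eta0)// lerDl.
Unshelve. all: by end_near. Qed.

End ParameterDependence.

(** * From dense to full reachable averages *)

Section DenseSubspace.
Variables (R : realType) (n : nat).

(** A row vector [v] with [v P = 0] satisfies [v = v (1 - P)], hence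
    [|v| <= n e |v|] with [n e < 1]. *)
Lemma near1_unitmx (P : 'M[R]_n) (e : R) :
  n%:R * e < 1 -> `|1%:M - P| <= e -> P \in unitmx.
Proof.
move=> ne Pe; rewrite -row_free_unit -kermx_eq0.
apply/rowV0P => v /sub_kermxP vP.
have vE : v = v *m (1%:M - P) by rewrite mulmxBr mulmx1 vP subr0.
apply/eqP; rewrite -normr_le0.
have : `|v| <= n%:R * e * `|v|.
  rewrite {1}vE (le_trans (norm_mulmx_le _ _))// mulrAC ler_wpM2r//.
  by rewrite ler_wpM2l.
have := normr_ge0 v; nra.
Qed.

(** Vectors of [W] close enough to the standard basis are still a basis. *)
Lemma dense_subspace_full (W : set 'cV[R]_n) : W !=set0 ->
  (forall a v w, W v -> W w -> W (a *: v + w)) ->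
  (forall y e, 0 < e -> exists2 w, W w & `|w - y| <= e) ->
  forall y, W y.
Proof.
move=> [w0 Ww0] lin dense y.
have W0 : W 0 by rewrite -(addNr w0) -scaleN1r; exact: lin.
(* Any [e] with [n e < 1] suits [near1_unitmx], including when [n = 0]. *)
pose e : R := (n%:R + 1)^-1.
have e0 : 0 < e by rewrite invr_gt0 ltr_wpDl.
have /choice[p pP] : forall j : 'I_n, exists p, W p /\ `|p - delta_mx j 0| <= e.
  by move=> j; have [p Wp pj] := dense (delta_mx j 0) e e0; exists p.
pose P : 'M[R]_n := \matrix_(i, j) p j i 0.
have uP : P \in unitmx.
  apply: (@near1_unitmx _ e).
    by rewrite -ltr_pdivlMr// div1r invrK ltrDl.
  apply: mx_norm_le => [|i j]; first exact: ltW.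
  have := le_trans (le_mx_entry (p j - delta_mx j 0) i 0) (pP j).2.
  by rewrite !mxE eqxx andbT distrC.
rewrite -(mulKVmx uP y); move: (invmx P *m y) => c.
have -> : P *m c = \sum_j c j 0 *: p j.
  apply/colP => i; rewrite summxE mxE; apply: eq_bigr => j _.
  by rewrite !mxE mulrC.
elim/big_ind : _ => // [v w Wv Ww|j _]; first by rewrite -[v]scale1r; exact: lin.
by rewrite -[_ *: _]addr0; apply: lin => //; exact: (pP j).1.
Qed.

End DenseSubspace.

(** * Comparison of norms *)

Section LnormComparison.
Local Open Scope ereal_scope.

(** For finite [p > 1] this is Hoelder's inequality against the indicator of [D],
    whose norm is 1 for every exponent because [D] has measure one; for infinite
    [p] the essential supremum is integrated over [D]. *)
Lemma Lnorm1_restrict_le (d : measure_display) (T : measurableType d)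
    (R : realType) (mu : {measure set T -> \bar R}) (D : set T) (f : T -> R)
    (p : \bar R) :
  measurable D -> mu D = 1 -> measurable_fun [set: T] (f \_ D) -> 1 <= p ->
  'N[mu]_1[EFin \o (f \_ D)] <= 'N[mu]_p[EFin \o (f \_ D)].
Proof.
move=> mD muD mf; case: p => [r| |] //; last first.
  move=> _.
  have muT : 0 < mu [set: T].
    rewrite (@lt_le_trans _ _ (mu D))// ?muD ?lte01// -muD.
    by apply: le_measure; rewrite ?inE.
  set F : T -> \bar R := EFin \o _.
  have -> : 'N[mu]_+oo[F] = ess_sup mu (abse \o F).
    by rewrite unlock muT.
  have -> : 'N[mu]_1[F] = \int[mu]_(x in D) `|F x|.
    rewrite Lnorm1 [RHS]integral_mkcond; apply: eq_integral => x _.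
    by rewrite /F /patch /=; case: ifP => //; rewrite normr0.
  rewrite -[leRHS]mule1 -muD -integral_cst//.
  apply: ae_ge0_le_integral => //.
  - apply: measurableT_comp => //; apply/measurable_EFinP.
    exact: measurable_funS mf.
  - by move=> x _; apply: ess_sup_gee => //; apply: nearW => t; exact: abse_ge0.
  - by apply: filterS (ess_sup_ge mu (abse \o F)) => x + _.
rewrite lee_fin le_eqVlt => /predU1P[<-//|r1].
have r0 : (0 < r)%R by rewrite (lt_trans ltr01).
have q0 : (0 < r / (r - 1))%R by rewrite divr_gt0// subr_gt0.
have {1}-> : f \_ D = (f \_ D \* \1_D)%R.
  apply/funext => x /=; rewrite /patch indicE.
  by case: ifP; rewrite ?mulr1 ?mul0r.
have pq : (r^-1 + (r / (r - 1))^-1 = 1)%R.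
  by field; rewrite !gt_eqF ?subr_gt0.
apply: le_trans (hoelder mu mf (measurable_indic mD) r0 q0 pq) _.
suff -> : 'N[mu]_(r / (r - 1))%:E[EFin \o \1_D] = 1 by rewrite mule1.
rewrite unlock.
have -> : \int[mu]_x `|(EFin \o \1_D) x| `^ (r / (r - 1)) = 1.
  rewrite -[RHS]muD -[D in RHS]setIT -integral_indic//.
  apply: eq_integral => x _ /=; rewrite indicE; case: (x \in D) => /=.
    by rewrite normr1 powR1.
  by rewrite normr0 powR0// gt_eqF.
by rewrite poweR1r.
Qed.

End LnormComparison.

(** * Ensemble controllability *)

Section EnsembleControllability.
Variables (R : realType).
Local Notation mu := (@lebesgue_measure R).

Lemma norm_le_enorm k (v : 'cV[R]_k) : `|v| <= enorm v.
Proof.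
apply: mx_norm_le => [|i j]; first exact: sqrtr_ge0.
rewrite ord1 -sqrtr_sqr ler_sqrt ?sumr_ge0//; last by move=> l _; exact: sqr_ge0.
by rewrite (bigD1 i)//= lerDl sumr_ge0// => l _; exact: sqr_ge0.
Qed.

Lemma continuous_enorm k : continuous (@enorm R k).
Proof.
move=> v; apply: continuous_comp; last exact: sqrt_continuous.
apply: (@cvg_big _ _ _ _ _ _ _ (nbhs v)) => [|i _]; first exact: add_continuous.
by apply: cvgM; exact: coord_continuous.
Qed.

Lemma norm_vintegral_le_Lp_norm (p : \bar R) k (f : R -> 'cV[R]_k) :
  (1 <= p)%E -> {within Sigma R, continuous f} ->
  (`|vintegral (Sigma R) f|%:E <= Lp_norm p f)%E.
Proof.
move=> p1 cf.
have mS : measurable (Sigma R : set (measurableTypeR R)) by exact: measurable_itv.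
have ienorm : mu.-integrable (Sigma R) (EFin \o (@enorm R k \o f)).
  apply: continuous_compact_integrable; first exact: segment_compact.
  move=> s; apply: (@cvg_comp _ _ _ f (@enorm R k)); first exact: cf.
  exact: continuous_enorm.
have menorm : measurable_fun [set: measurableTypeR R]
    ((@enorm R k \o f) \_ (Sigma R)).
  apply/(measurable_restrictT (@enorm R k \o f) mS).
  by apply/measurable_EFinP; case/integrableP : ienorm.
have := Lnorm1_restrict_le mS (@lebesgue_measure_Sigma R) menorm p1.
rewrite -restrict_EFin; apply: le_trans.
rewrite Lnorm1.
have -> : (\int[mu]_x `|((EFin \o (@enorm R k \o f)) \_ (Sigma R)) x|)%E =
    (\int[mu]_(x in Sigma R) (EFin \o (@enorm R k \o f)) x)%E.
  rewrite [RHS]integral_mkcond; apply: eq_integral => x _.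
  rewrite /patch /=; case: ifP => _ /=; last by rewrite normr0.
  by rewrite ger0_norm// sqrtr_ge0.
rewrite -[leRHS]fineK ?lee_fin; last exact: integrable_fin_num.
apply: normr_vintegral_le => //; first exact: vintegrable_Sigma.
by move=> t _; exact: norm_le_enorm.
Qed.

(** Here [W] is the set of averages reached from the zero profile, and the
    constant target profiles provide its density. *)
Lemma averaged_controllable_of_Lp n m (p : \bar R) (A : R -> 'M[R]_n)
    (B : R -> 'M[R]_(n, m)) :
  {within Sigma R, continuous A} -> {within Sigma R, continuous B} ->
  (1 <= p)%E -> Lp_controllable p A B -> averaged_controllable A B.
Proof.
move=> cA cB p1 ctrl x0 xinit cxinit _ xstar T T0.
have mS : measurable (Sigma R : set (measurableTypeR R)) by exact: measurable_itv.
have cst_continuous k (v : 'cV[R]_k) : {within Sigma R, continuous (fun=> v)}.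
  by apply: continuous_subspaceT => t; exact: cvg_cst.
have final_continuous u x xi : L1_control T u -> ensemble_trajectory A B T u x ->
    {within Sigma R, continuous xi} -> (forall s, Sigma R s -> x 0 s = xi s) ->
    {within Sigma R, continuous (x T)}.
  move=> uT tx cxi xxi.
  apply: (trajectory_continuous_parameter (ltW T0) cA cB uT tx).
  apply: (@subspace_eq_continuous _ _ _ xi) => // s /set_mem Ss.
  by rewrite [RHS]xxi.
pose W : set 'cV[R]_n := [set w | exists u x, [/\ L1_control T u,
  ensemble_trajectory A B T u x, forall s, Sigma R s -> x 0 s = 0 &
  vintegral (Sigma R) (x T) = w]].
have Wdense y e : 0 < e -> exists2 w, W w & `|w - y| <= e.
  move=> e0; have [u [x [uT tx xx0 xy]]] :=
    ctrl (fun=> 0) (fun=> y) (cst_continuous _ _) (cst_continuous _ _) e T e0 T0.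
  exists (vintegral (Sigma R) (x T)); first by exists u, x.
  have cx := final_continuous u x _ uT tx (cst_continuous _ 0) xx0.
  rewrite -lee_fin; apply: le_trans (ltW xy).
  have -> : vintegral (Sigma R) (x T) - y =
      vintegral (Sigma R) (fun s => x T s - y).
    under [in RHS]eq_fun do rewrite -[x T _]scale1r.
    by rewrite vintegral_lin ?vintegral_Sigma_cst ?scale1r//;
      exact: vintegrable_Sigma.
  apply: norm_vintegral_le_Lp_norm => //.
  exact: (within_continuousB cx (cst_continuous _ y)).
have Wlin a v w : W v -> W w -> W (a *: v + w).
  move=> [u [x [uT tx xx0 <-]]] [u' [x' [uT' tx' xx0' <-]]].
  exists (fun t => a *: u t + u' t), (fun t s => a *: x t s + x' t s); split.
  - exact: L1_control_lin.
  - by move=> s Ss; apply: trajectory_lin => //; [exact: tx|exact: tx'].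
  - by move=> s Ss; rewrite xx0// xx0'// scaler0 addr0.
  - have cx := final_continuous u x _ uT tx (cst_continuous _ 0) xx0.
    have cx' := final_continuous u' x' _ uT' tx' (cst_continuous _ 0) xx0'.
    by rewrite vintegral_lin//; exact: vintegrable_Sigma.
have [u [x [uT tx xxi _]]] :=
  ctrl xinit xinit cxinit cxinit 1 T ltr01 T0.
have [w0 Ww0 _] := Wdense 0 1 ltr01.
have [v [y [vT ty y0 yT]]] :=
  dense_subspace_full (ex_intro _ w0 Ww0) Wlin Wdense
    (xstar - vintegral (Sigma R) (x T)).
exists (fun t => 1 *: u t + v t), (fun t s => 1 *: x t s + y t s); split.
- exact: L1_control_lin.
- by move=> s Ss; apply: trajectory_lin => //; [exact: tx|exact: ty].
- by move=> s Ss; rewrite y0// addr0 scale1r xxi.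
- have cx := final_continuous u x _ uT tx cxinit xxi.
  have cy := final_continuous v y _ vT ty (cst_continuous _ 0) y0.
  rewrite vintegral_lin//; try exact: vintegrable_Sigma.
  by rewrite yT scale1r addrC subrK.
Qed.

End EnsembleControllability.

(** * Structural averaged controllability *)

Theorem proposition2p1 (R : realType) (n m : nat)
    (hn : (0 < n)%N) (hm : (0 < m)%N) (G : sparsity_pattern n m) :
  (structurally_controllable R G -> structurally_averaged_controllable R G) /\
  (structurally_ensemble_controllable R G ->
   structurally_averaged_controllable R G).
Proof.
split.
- move=> [A [B [GAB ctrl]]]; exists (fun=> A), (fun=> B).
  split; last exact: averaged_controllable_cst.
  by split=> //; apply: continuous_subspaceT => s; exact: cvg_cst.
- move=> [A [B [[cA cB GAB] [p [p1 ctrl]]]]]; exists A, B; split=> //.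
  exact: averaged_controllable_of_Lp ctrl.
Qed.
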